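(* Let $A,C,H$ be logically independent events, with $A\neq\emptyset$ and $H\neq\emptyset$. Let $(x,y)$ be any coherent assessment on $\{A|H,\; C|(A|H)\}$, that is, $x=P(A|H)$ and $y=\mathbb{P}[C|(A|H)]$. Then the extension $z=P(C)$ is coherent (i.e., the assessment $(x,y,z)$ on $\{A|H,\;C|(A|H),\;C\}$ is coherent) if and only if $z\in[z',z'']$, where $$z'=xy\quad\text{and}\quad z''=xy+1-x .$$
   Context: Events. Events are two-valued (true/false) logical entities, i.e. elements of a Boolean algebra (equivalently, subsets of a set $\Omega$); $\Omega$ is the sure event, $\emptyset$ the impossible event, $AB=A\wedge B$ is conjunction, $A\vee B$ disjunction, $\overline{A}$ negation. An event is identified with its $0/1$ indicator. Events $E_1,\dots,E_n$ are logically independent if all $2^n$ conjunctions $E_1^*\cdots E_n^*$, with each $E_i^*\in\{E_i,\overline{E_i}\}$, are different from $\emptyset$. Conditional random quantities. For a random quantity $X$ with finitely many values, an event $H\ne\emptyset$ and the prevision $\mu=\mathbb{P}(X|H)$, the conditional random quantity $X|H$ is identified with $XH+\mu\overline{H}$; a bet on $X|H$ is called off when $H$ is false. In particular, the conditional event $A|H$ with $x=P(A|H)$ is $AH+x\overline{H}$, and the negation of $A|H$ is $\overline{A}|H=1-A|H$, with $P(\overline{A}|H)=1-x$. An unconditional event $C$ is $C|\Omega$. Conjunction with an unconditional event. With $x=P(A|H)$, $(A|H)\wedge C=\min\{A|H,C\}$, which equals $AHC+x\,\overline{H}C$. Iterated conditional. With $x=P(A|H)$ and $y=\mathbb{P}[C|(A|H)]$,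 the iterated conditional is the random quantity $C|(A|H)=C\wedge(A|H)+y\,(\overline{A}|H)$. Its value is $1$ on $AHC$, $0$ on $AH\overline{C}$, $y$ on $\overline{A}H$, $x+y(1-x)$ on $\overline{H}C$, and $y(1-x)$ on $\overline{H}\,\overline{C}$. For checking coherence, the bet on $C|(A|H)$ must be called off when $C|(A|H)$ coincides with its prevision $y$; accordingly the bet is in force exactly on the event $AH\vee\overline{H}$ if $x>0$, and exactly on the event $AH$ if $x=0$ (in which case $C|(A|H)=C|AH$). Coherence. Consider a finite family of quantities $X_1,\dots,X_n$ with assessed previsions $\mu_1,\dots,\mu_n$, where the bet on the $i$-th quantity is in force exactly on the event $E_i$ (for $A|H$: $X=A$, $E=H$; for $C|(A|H)$: $X$ is the random quantity equal to $1$ on $AHC$, $0$ on $AH\overline{C}$, $y$ on $\overline{A}H$, $x+y(1-x)$ on $\overline{H}C$, $y(1-x)$ on $\overline{H}\,\overline{C}$, and $E=AH\vee\overline{H}$ if $x>0$, $E=AH$ if $x=0$; for $C$: $X=C$, $E=\Omega$). The assessment $(\mu_1,\dots,\mu_n)$ is coherent if and only if, for every nonempty $J\subseteq\{1,\dots,n\}$ and all real numbers $s_i$ ($i\in J$), the random gain $G=\sum_{i\in J}s_iE_i(X_i-\mu_i)$, restricted to the event $\bigvee_{i\in J}E_i$, satisfies $\min G\le 0\le\max G$. Equivalently, for every nonempty $J$, the point $(\mu_i)_{i\in J}$ lies in the convex hull of the points $Q_h=(q_{hi})_{i\in J}$ associated with the constituents (possible worlds) $C_h\subseteq\bigvee_{i\in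 J}E_i$, where $q_{hi}$ is the value of $X_i$ on $C_h$ if $C_h\subseteq E_i$, and $q_{hi}=\mu_i$ if $C_h\subseteq\overline{E_i}$. *)

(* Defs.v *)
From HB Require Import structures.
From mathcomp Require Import all_boot all_order all_algebra.
From mathcomp Require Import boolp classical_sets functions reals numfun.

Set Implicit Arguments.
Unset Strict Implicit.
Unset Printing Implicit Defensive.

Import Order.TTheory GRing.Theory Num.Theory.
Local Open Scope classical_set_scope.
Local Open Scope ring_scope.

(* Events are subsets of the sure event [set: Omega], for an
   arbitrary type Omega of possible worlds. *)

Definition logically_independent (Omega : Type) (n : nat)
    (E : n.-tuple (set Omega)) : Prop :=
  forall e : 'I_n -> bool,
    \bigcap_(i : 'I_n) (if e i then tnth E i else ~` tnth E i) !=set0.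

Section RandomQuantities.
Context {R : realType} {Omega : Type}.
Implicit Types (A C H : set Omega) (X : Omega -> R) (mu x y : R).

Definition cond_quantity X H mu : Omega -> R :=
  fun w => X w * \1_H w + mu * \1_(~` H) w.

Definition cond_event A H x : Omega -> R := cond_quantity \1_A H x.

Definition conj_cond A H x C : Omega -> R :=
  fun w => Num.min (cond_event A H x w) (\1_C w).

Definition iterated_cond A H x C y : Omega -> R :=
  fun w => conj_cond A H x C w + y * (1 - cond_event A H x w).

(* The tabulated values of C|(A|H); the bounds on x are those imposed by the
   coherence of x = P(A|H), and are needed only when H is false. *)
Lemma iterated_condE A H C x y w : 0 <= x <= 1 ->
  iterated_cond A H x C y w =
    if w \in H then
      if w \in A then (if w \in C then 1 else 0) else y
    else if w \in C then x + y * (1 - x) else y * (1 - x).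
Proof.
move=> /andP[x0 x1].
rewrite /iterated_cond /conj_cond /cond_event /cond_quantity !indicE in_setC.
case: (w \in H); case: (w \in A); case: (w \in C) => /=;
  rewrite ?(mulr1, mulr0, addr0, add0r, subrr, subr0, minxx) //.
- by rewrite min_r ?ler01.
- by rewrite min_l ?ler01 // add0r.
- by rewrite min_l.
- by rewrite min_r // add0r.
- by rewrite min_l.
- by rewrite min_r // add0r.
Qed.

(* A bet at price [prevision] on [quantity], in force exactly on [active]. *)
Record bet := Bet {
  quantity : Omega -> R;
  active : set Omega;
  prevision : R }.

Definition bet_cond A H x : bet := Bet \1_A H x.

(* When x = 0 the bet is also called off outside H, as C|(A|H) then takes the
   value y there. The [else] branch formally covers x < 0 as well, a case in
   which the assessment is incoherent already because of A|H. *)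
Definition bet_iterated A H x C y : bet :=
  Bet (iterated_cond A H x C y)
      (if 0 < x then (A `&` H) `|` ~` H else A `&` H) y.

Definition bet_event C (z : R) : bet := Bet \1_C [set: Omega] z.

Definition gain (n : nat) (b : n.-tuple bet) (J : {set 'I_n}) (s : 'I_n -> R) :
    Omega -> R :=
  fun w => \sum_(i in J) s i * \1_(active (tnth b i)) w *
             (quantity (tnth b i) w - prevision (tnth b i)).

Definition some_active (n : nat) (b : n.-tuple bet) (J : {set 'I_n}) :
    set Omega :=
  \bigcup_(i in [set i | i \in J]) active (tnth b i).

Definition is_min (S : set R) (m : R) : Prop := S m /\ lbound S m.
Definition is_max (S : set R) (m : R) : Prop := S m /\ ubound S m.

(* Meant for quantities with finitely many values and nonempty active events,
   so that the minimum and the maximum of the gain exist. *)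
Definition coherent (n : nat) (b : n.-tuple bet) : Prop :=
  forall (J : {set 'I_n}) (s : 'I_n -> R), J != finset.set0 ->
    exists m M : R,
      [/\ is_min (gain b J s @` some_active b J) m,
          is_max (gain b J s @` some_active b J) M
        & m <= 0 <= M].

End RandomQuantities.

(* Main.v *)
Require Import Defs.
From mathcomp Require Import all_boot all_order all_algebra.
From mathcomp Require Import boolp classical_sets functions reals numfun.
From mathcomp Require Import lra.
Import Order.TTheory GRing.Theory Num.Theory.
Local Open Scope classical_set_scope.
Local Open Scope ring_scope.

(** The truth values of [A], [C] and [H] split the worlds into eight
    constituents, all of them inhabited by logical independence; every bet has
    a constant payoff on each of them. Coherence thus becomes a question about
    finitely many points in the space of previsions.

    That an assessment is coherent is shown by exhibiting, for each set [J] of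
    bets, a probability on the constituents where [J] is active which makes
    every bet of [J] fair ([coherent_of_fair_weights]): the expected gain is
    then [0], so the gain is neither everywhere positive nor everywhere
    negative. For [z] in the interval, a single probability serves nearly all
    [J]; it lives on [H] and gives
      [AHC] weight [x * y],                 [A H ~C] weight [x * (1 - y)],
      [~A H C] weight [z - x * y],          [~A H ~C] weight [x * y + 1 - x - z].
    The last two weights are nonnegative exactly when [z] lies in the interval.
    The exception is the bet on [C|(A|H)] alone, which is off on [~A H]: there,
    weights [y] and [1 - y] on [AHC] and [A H ~C] do.

    Conversely, outside the interval there is a sure loss. On [AH] the random
    quantities [C] and [C|(A|H)] take the same value, so buying one and selling
    the other leaves only a risk outside [AH], which a stake on [A|H] can hedge.
    With stakes [1 - y], [-1], [1] the best gain is [x * y + 1 - x - z]; with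
    stakes [y], [1], [-1] it is [z - x * y]. Neither may be negative. *)

(** * Coherence through finitely many worlds *)

Section Coherence.
Context {R : realType} {Omega : Type}.
Implicit Types (A C H : set Omega) (x y z : R).

Definition payoff (b : @bet R Omega) (w : Omega) : R :=
  \1_(active b) w * (quantity b w - prevision b).

Lemma gainE n (b : n.-tuple (@bet R Omega)) (J : {set 'I_n}) (s : 'I_n -> R) w :
  gain b J s w = \sum_(i in J) s i * payoff (tnth b i) w.
Proof. by apply: eq_bigr => i _; rewrite mulrA. Qed.

(** Staking the opposite amounts turns this into the bound for the minimum. *)
Lemma coherent_gain_ge0 n (b : n.-tuple (@bet R Omega)) (J : {set 'I_n})
    (s : 'I_n -> R) :
  coherent b -> J != finset.set0 ->
  exists2 w, some_active b J w & 0 <= gain b J s w.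
Proof.
move=> cohb J0; have [m [M [_ [[w Jw wM] _] /andP[_ M0]]]] := cohb J s J0.
by exists w => //; rewrite wM.
Qed.

Lemma coherent_payoff_ge0 n (b : n.-tuple (@bet R Omega)) (i : 'I_n) (t : R) :
  coherent b ->
  exists2 w, active (tnth b i) w & 0 <= t * payoff (tnth b i) w.
Proof.
move=> cohb.
have [|w [j /set1P -> iw] gain0] :=
  coherent_gain_ge0 n b (finset.set1 i) (fun=> t) cohb.
  by apply/set0Pn; exists i; apply/set1P.
by exists w => //; move: gain0; rewrite gainE big_set1.
Qed.

(** Only the worlds [rep k] matter, so the extrema of the gain exist. The
    weights [p] make the gain have mean [0], which bounds both extrema. Only
    constituents where the bets of [J] are not all called off may be weighted:
    a gain of [0] elsewhere does not count. *)
Lemma coherent_of_fair_weights n (b : n.-tuple (@bet R Omega)) (I : finType)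
    (rep : I -> Omega) (cls : Omega -> I) :
  (forall i w, (rep (cls w) \in active (tnth b i)) =
               (w \in active (tnth b i))) ->
  (forall i w, quantity (tnth b i) (rep (cls w)) = quantity (tnth b i) w) ->
  (forall J : {set 'I_n}, J != finset.set0 -> exists p : I -> R,
    [/\ forall k, 0 <= p k,
        \sum_k p k = 1,
        forall k, p k != 0 -> some_active b J (rep k)
      & forall i, i \in J ->
          \sum_k p k * payoff (tnth b i) (rep k) = 0]) ->
  coherent b.
Proof.
move=> act_cls q_cls fair J s J0; have [p [p_ge0 p1 p_act p_fair]] := fair J J0.
set f := fun k => gain b J s (rep k).
have gain_cls w : gain b J s w = f (cls w).
  rewrite /f !gainE; apply: eq_bigr => i _.
  by rewrite /payoff !indicE act_cls q_cls.
pose P k := `[< some_active b J (rep k) >].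
have P_cls w : some_active b J w -> P (cls w).
  move=> [i iJ iw]; apply/asboolP; exists i => //.
  by apply: set_mem; rewrite act_cls; apply: mem_set.
have mean0 : \sum_k p k * f k = 0.
  under eq_bigr do rewrite /f gainE big_distrr /=.
  rewrite exchange_big /= big1 // => i iJ.
  under eq_bigr do rewrite mulrCA.
  by rewrite -big_distrr /= p_fair // mulr0.
have [k0 Pk0] : exists k0, P k0.
  apply: contrapT => noP; have /eqP := p1; rewrite big1 ?(eq_sym 0) ?oner_eq0 //.
  move=> k _; apply/eqP/negPn/negP => pk; apply: noP; exists k.
  exact/asboolP/p_act.
(* a bound of [f] on the active constituents is a bound of its mean *)
have mean_ge m : (forall k, P k -> m <= f k) -> m <= 0.
  move=> mf; rewrite -mean0 -[m]mul1r -p1 big_distrl /=.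
  apply: ler_sum => k _; have [->|pk] := eqVneq (p k) 0; first by rewrite !mul0r.
  by apply: ler_wpM2l => //; apply/mf/asboolP/p_act.
have mean_le M : (forall k, P k -> f k <= M) -> 0 <= M.
  move=> fM; rewrite -mean0 -[M]mul1r -p1 big_distrl /=.
  apply: ler_sum => k _; have [->|pk] := eqVneq (p k) 0; first by rewrite !mul0r.
  by apply: ler_wpM2l => //; apply/fM/asboolP/p_act.
have [k1 Pk1 k1min] := @Order.TotalTheory.arg_minP _ R I k0 P f Pk0.
have [k2 Pk2 k2max] := @Order.TotalTheory.arg_maxP _ R I k0 P f Pk0.
exists (f k1), (f k2); split.
- split; first by exists (rep k1) => //; apply/asboolP.
  by move=> _ [w Jw <-]; rewrite gain_cls; apply/k1min/P_cls.
- split; first by exists (rep k2) => //; apply/asboolP.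
  by move=> _ [w Jw <-]; rewrite gain_cls; apply/k2max/P_cls.
- by rewrite mean_ge // mean_le.
Qed.

Lemma logically_independent_world n (E : n.-tuple (set Omega)) :
  logically_independent E -> forall e : 'I_n -> bool,
  exists w, forall i, (w \in tnth E i) = e i.
Proof.
move=> indep e; have [w Ew] := indep e; exists w => i.
have /= := Ew i I; case: (e i) => Eiw; first exact: mem_set.
by apply/negbTE/negP => /set_mem.
Qed.

(** * The three bets *)

Lemma payoff_cond A H x w :
  payoff (bet_cond A H x) w = (w \in H)%:R * ((w \in A)%:R - x).
Proof. by rewrite /payoff /= !indicE. Qed.

Lemma payoff_event C z w : payoff (bet_event C z) w = (w \in C)%:R - z.
Proof. by rewrite /payoff /= !indicE in_setT mul1r. Qed.

(** The two regimes [0 < x] and [x = 0] of the bet agree: where they disagree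
    about calling it off, namely on [~H], the payoff has a factor [x]. *)
Lemma payoff_iterated A H x C y w : 0 <= x <= 1 ->
  payoff (bet_iterated A H x C y) w =
    (if w \in H then (w \in A)%:R else x) * ((w \in C)%:R - y).
Proof.
move=> x01; rewrite /payoff /= iterated_condE // indicE.
have [x_gt0|x_le0] := ltrP 0 x.
  rewrite in_setU in_setI in_setC.
  by case: (w \in H); case: (w \in A); case: (w \in C) => /= *; lra.
have -> : x = 0 by lra.
rewrite in_setI.
by case: (w \in H); case: (w \in A); case: (w \in C) => /= *; lra.
Qed.

Lemma in_active_iterated A H x C y w :
  (w \in active (bet_iterated A H x C y)) =
    if w \in H then w \in A else 0 < x.
Proof.
rewrite /=; case: ifP; rewrite ?in_setU in_setI ?in_setC;
  by case: (w \in H); case: (w \in A).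
Qed.

(** In force, the bet on [C|(A|H)] pays a positive multiple of [C - y], so on
    its own it constrains [y] as an ordinary bet on [C] would. *)
Lemma coherent_pair_bounds A C H x y :
  coherent [tuple bet_cond A H x; bet_iterated A H x C y] ->
  0 <= x <= 1 /\ 0 <= y <= 1.
Proof.
move=> coh.
have x01 : 0 <= x <= 1.
  have [w /mem_set /= Hw] := coherent_payoff_ge0 _ _ ord0 1 coh.
  have [v /mem_set /= Hv] := coherent_payoff_ge0 _ _ ord0 (-1) coh.
  rewrite !(tnth_nth (bet_cond A H x)) /= !payoff_cond Hw Hv.
  by case: (w \in A); case: (v \in A) => /= ? ?; lra.
split=> //.
have [w] := coherent_payoff_ge0 _ _ (inord 1) 1 coh.
have [v] := coherent_payoff_ge0 _ _ (inord 1) (-1) coh.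
rewrite !(tnth_nth (bet_cond A H x)) inordK //=.
move=> /mem_set; rewrite (in_active_iterated A H x C y) payoff_iterated // => actv v0.
move=> /mem_set; rewrite (in_active_iterated A H x C y) payoff_iterated // => actw w0.
(* the factor of the payoff is positive wherever the bet is in force *)
have factor_gt0 u : (if u \in H then u \in A else 0 < x) ->
    0 < (if u \in H then (u \in A)%:R else x).
  by case: (u \in H) => // ->.
move: v0; rewrite mulN1r -mulrN pmulr_rge0 ?factor_gt0 // => v0.
move: w0; rewrite mul1r pmulr_rge0 ?factor_gt0 // => w0.
by move: v0 w0; case: (v \in C); case: (w \in C) => /= *; lra.
Qed.

Lemma sum_bool3 (F : bool * bool * bool -> R) :
  \sum_k F k = F (true, true, true) + F (true, true, false)
    + (F (true, false, true) + F (true, false, false))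
    + (F (false, true, true) + F (false, true, false)
    + (F (false, false, true) + F (false, false, false))).
Proof.
rewrite (eq_bigr (fun k => F (k.1, k.2))); last by case.
rewrite -(pair_bigA _ (fun u v => F (u, v))) /=.
rewrite (eq_bigr (fun u => \sum_v F (u.1, u.2, v))); last by case.
rewrite -(pair_bigA _ (fun u t => \sum_v F (u, t, v))) /=.
by rewrite !big_bool.
Qed.

End Coherence.

(** * The interval of coherent extensions *)

Theorem theorem4 (R : realType) (Omega : Type) (A C H : set Omega)
  (indep : logically_independent [tuple A; C; H])
  (A_neq0 : A !=set0) (H_neq0 : H !=set0)
  (x y : R)
  (coh_xy : coherent [tuple bet_cond A H x; bet_iterated A H x C y])
  (z : R) :
  coherent [tuple bet_cond A H x; bet_iterated A H x C y; bet_event C z]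
  <-> z \in `[x * y, x * y + 1 - x]%R.
Proof.
have [x01 y01] := coherent_pair_bounds A C H x y coh_xy.
set b := [tuple _; _; _].
have ord3 (i : 'I_3) : [\/ i = ord0, i = inord 1 | i = inord 2].
  by case: i => [[|[|[|//]]] i3]; [constructor 1|constructor 2|constructor 3];
    apply: val_inj; rewrite /= ?inordK.
have b0 : tnth b ord0 = bet_cond A H x by [].
have b1 : tnth b (inord 1) = bet_iterated A H x C y.
  by rewrite (tnth_nth (bet_cond A H x)) inordK.
have b2 : tnth b (inord 2) = bet_event C z.
  by rewrite (tnth_nth (bet_cond A H x)) inordK.
split=> [coh|]; rewrite in_itv /=.
(* [C] is bought and [C|(A|H)] sold in the same amount [t] *)
- have trade r t : exists w, 0 <= r * ((w \in H)%:R * ((w \in A)%:R - x))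
      - t * ((if w \in H then (w \in A)%:R else x) * ((w \in C)%:R - y))
      + t * ((w \in C)%:R - z).
    have [|w _] := coherent_gain_ge0 _ b [set: _]%SET
      (fun i => nth 0 [:: r; - t; t] i) coh.
      by apply/set0Pn; exists ord0.
    rewrite gainE (eq_bigl xpredT) => [|i]; last by rewrite finset.in_setT.
    rewrite !big_ord_recl big_ord0 /=.
    rewrite (_ : lift ord0 ord0 = inord 1); last first.
      by apply: val_inj; rewrite /= inordK.
    rewrite (_ : lift ord0 (lift ord0 ord0) = inord 2); last first.
      by apply: val_inj; rewrite /= inordK.
    rewrite b0 b1 b2 payoff_cond payoff_iterated // payoff_event.
    by rewrite addr0 mulNr addrA => w0; exists w.
  have [w] := trade (1 - y) 1; have [v] := trade y (-1).
  by case: (v \in H); case: (v \in A); case: (v \in C);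
     case: (w \in H); case: (w \in A); case: (w \in C) => /= *; nra.
- move=> /andP[z_ge z_le].
  have wP (k : bool * bool * bool) :
      {w | [/\ (w \in A) = k.1.1, (w \in C) = k.1.2 & (w \in H) = k.2]}.
    apply: cid; have [w wE] := logically_independent_world _ _ indep
      (fun i => nth true [:: k.1.1; k.1.2; k.2] i).
    by exists w; split; [have := wE ord0|have := wE (inord 1)|have := wE (inord 2)];
      rewrite (tnth_nth A) ?inordK.
  pose rep k := sval (wP k).
  have repA k : (rep k \in A) = k.1.1 by rewrite /rep; case: (wP k) => w [].
  have repC k : (rep k \in C) = k.1.2 by rewrite /rep; case: (wP k) => w [].
  have repH k : (rep k \in H) = k.2 by rewrite /rep; case: (wP k) => w [].
  apply: (coherent_of_fair_weights _ b _ rep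
            (fun w => (w \in A, w \in C, w \in H))) => [i w|i w|J J0].
  + have [->|->|->] := ord3 i; rewrite ?b0 ?b1 ?b2.
    * by rewrite /= repH.
    * by rewrite !(in_active_iterated A H x C y) repA repH.
    * by rewrite /= !in_setT.
  + have [->|->|->] := ord3 i; rewrite ?b0 ?b1 ?b2 /= ?iterated_condE //.
    * by rewrite !indicE repA.
    * by rewrite repA repC repH.
    * by rewrite !indicE repC.
  + have [J1|J1] := boolP ((ord0 \in J) || (inord 2 \in J)).
    * exists (fun k => if k.2 then
        if k.1.1 then if k.1.2 then x * y else x * (1 - y)
        else if k.1.2 then z - x * y else x * y + 1 - x - z else 0).
      split.
      - by move=> [[[] []] []] /=; nra.
      - by rewrite sum_bool3 /=; lra.
      - move=> k; have [k2 _|] := boolP k.2; last by rewrite eqxx.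
        case/orP: J1 => iJ; [exists ord0|exists (inord 2)] => //.
          by rewrite b0; apply: set_mem; rewrite /= repH.
        by rewrite b2.
      - move=> i _; rewrite sum_bool3 /=.
        by have [->|->|->] := ord3 i; rewrite ?b0 ?b1 ?b2
          ?payoff_cond ?payoff_iterated ?payoff_event // ?repA ?repC ?repH /=; lra.
    (* only the bet on [C|(A|H)], whose weights must avoid [~A H] *)
    * have Ji i : i \in J -> i = inord 1.
        move=> iJ; case: (ord3 i) => // Ei; case/orP: J1; rewrite -Ei; by [left|right].
      exists (fun k => if k.2 && k.1.1 then if k.1.2 then y else 1 - y else 0).
      split.
      - by move=> [[[] []] []] /=; lra.
      - by rewrite sum_bool3 /=; lra.
      - move=> k; case: ifP => [/andP[k2 k11] _|]; last by rewrite eqxx.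
        have /set0Pn[i iJ] := J0; exists i => //; rewrite (Ji i iJ) b1.
        by apply: set_mem; rewrite in_active_iterated repH repA k2.
      - move=> i /Ji ->; rewrite sum_bool3 /= b1 !payoff_iterated //.
        by rewrite !repA !repC !repH /=; lra.
Qed.
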